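(* Let $\mathscr{A}$ be a small category and let $M:\mathscr{A}^{op}\times\mathscr{A}\to\mathsf{Set}$ be a flat module such that $\mathsf{Complex}(M)$ is nonempty. Suppose that $M$ is compact. If $(\mathscr{A},M)$ satisfies the Weak Solvability Condition, then $(\mathscr{A},M)$ satisfies the Strong Solvability Condition.
   Context: A functor $X:\mathscr{A}\to\mathsf{Set}$ is flat if its category of elements is cofiltered; this category has as objects the pairs $(x,a)$ with $x\in Xa$, and as morphisms $(x,a)\to(x',a')$ those $f:a\to a'$ in $\mathscr{A}$ with $Xf(x)=x'$. A module on $\mathscr{A}$ is a functor $M:\mathscr{A}^{op}\times\mathscr{A}\to\mathsf{Set}$; it is flat if every $M(a,-):\mathscr{A}\to\mathsf{Set}$ is a flat functor. For $m\in M(a,b)$, $f:a'\to a$ and $g:b\to b'$ write $m@f=M(f,b)(m)$ and $g@m=M(a,g)(m)$. $\mathsf{Complex}(M)$: objects ($M$-complexes) are sequences $(a_n)_{n\ge 0}$ of objects of $\mathscr{A}$ together with elements $m_{n+1}\in M(a_{n+1},a_n)$ for all $n\geq 0$; a morphism from $(a_\bullet,m_\bullet)$ to $(a'_\bullet,m'_\bullet)$ is a sequence $f_n:a_n\to a'_n$ ($n\ge 0$) with $m'_{n+1}@f_{n+1}=f_n@m_{n+1}$ for all $n\ge 0$. For $n\geq 0$, $\mathsf{Complex}_n(M)$ is the category of $n$-truncated complexes $(a_n,\dots,a_0;m_n,\dots,m_1)$ with $m_{i+1}\in M(a_{i+1},a_i)$, and morphisms defined analogously; $\mathsf{Complex}_0(M)=\mathscr{A}$.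 The truncation functor is $\mathrm{pr}_n:\mathsf{Complex}(M)\to\mathsf{Complex}_n(M)$. A functor $F:\mathscr{X}\to\mathscr{Y}$ is cofiltering if for every functor $D:\mathscr{D}\to\mathscr{X}$ with $\mathscr{D}$ a finite category there exists a cone for $F\cdot D$ in $\mathscr{Y}$. Weak Solvability Condition: the functor $\mathrm{pr}_0:\mathsf{Complex}(M)\to\mathsf{Complex}_0(M)=\mathscr{A}$ is cofiltering. Strong Solvability Condition: the category $\mathsf{Complex}(M)$ is cofiltered. For a diagram $D:\mathscr{D}\to\mathsf{Complex}(M)$ with $\mathscr{D}$ finite, $\mathscr{P}^D_n$ is the preorder whose points are the cones for $\mathrm{pr}_n\cdot D:\mathscr{D}\to\mathsf{Complex}_n(M)$, with $c\sqsubseteq_n c'$ iff the cone $c$ factors through the cone $c'$. A subset $S$ of a preorder $X$ is final if for every $x\in X$ there is $s\in S$ with $x\sqsubseteq s$. The module $M$ is compact if $\mathscr{P}^D_n$ has a nonempty finite final subset for each $n\ge 0$ and each finite nonempty diagram $D:\mathscr{D}\to\mathsf{Complex}(M)$. *)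

(* Defs.v *)
From mathcomp Require Import all_boot boolp classical_sets cardinality.

Set Implicit Arguments.
Unset Strict Implicit.
Unset Printing Implicit Defensive.

(* Objects and morphisms both live in [Type], so every [Category] is small
   relative to the ambient universe; [Type] plays the role of Set. *)
Record Category := MkCategory {
  ob :> Type;
  hom : ob -> ob -> Type;
  idm : forall a, hom a a;
  comp : forall a b c, hom b c -> hom a b -> hom a c;
  comp_idl : forall a b (f : hom a b), comp (idm b) f = f;
  comp_idr : forall a b (f : hom a b), comp f (idm a) = f;
  comp_assoc : forall a b c d (h : hom c d) (g : hom b c) (f : hom a b),
    comp h (comp g f) = comp (comp h g) f }.
Arguments hom {_} _ _.
Arguments idm {_} a.
Arguments comp {_ a b c} _ _.

Record Functor (X Y : Category) := MkFunctor {
  fob :> X -> Y;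
  fmap : forall x x' : X, hom x x' -> hom (fob x) (fob x');
  fmap_id : forall x, fmap (idm x) = idm (fob x);
  fmap_comp : forall x y z (g : hom y z) (f : hom x y),
    fmap (comp g f) = comp (fmap g) (fmap f) }.
Arguments fmap {X Y} _ {x x'} _.

Definition comp_functor (X Y Z : Category) (G : Functor Y Z) (F : Functor X Y) :
  Functor X Z.
Proof.
refine (@MkFunctor X Z (fun x => G (F x))
  (fun x x' f => fmap G (fmap F f)) _ _).
- by move=> x; rewrite !fmap_id.
- by move=> x y z g f; rewrite !fmap_comp.
Defined.

Definition op_cat (A : Category) : Category.
Proof.
refine (@MkCategory A (fun a b => hom b a) (fun a => idm a)
  (fun a b c g f => comp f g) _ _ _).
- by move=> a b f; apply: comp_idr.
- by move=> a b f; apply: comp_idl.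
- by move=> a b c d h g f; rewrite comp_assoc.
Defined.

Definition prod_cat (A B : Category) : Category.
Proof.
refine (@MkCategory (A * B)%type
  (fun x y => (hom x.1 y.1 * hom x.2 y.2)%type)
  (fun x => (idm x.1, idm x.2))
  (fun x y z g f => (comp g.1 f.1, comp g.2 f.2)) _ _ _).
- by move=> a b [f g] /=; rewrite !comp_idl.
- by move=> a b [f g] /=; rewrite !comp_idr.
- by move=> a b c d h g f /=; rewrite !comp_assoc.
Defined.

Record SetFunctor (A : Category) := MkSetFunctor {
  sob :> A -> Type;
  smap : forall a a' : A, hom a a' -> sob a -> sob a';
  smap_id : forall a (x : sob a), smap (idm a) x = x;
  smap_comp : forall a b c (g : hom b c) (f : hom a b) (x : sob a),
    smap (comp g f) x = smap g (smap f x) }.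
Arguments smap {A} _ {a a'} _ _.

Definition elt_hom (A : Category) (X : SetFunctor A) (p q : {a : A & X a}) :=
  {f : hom (tag p) (tag q) | smap X f (tagged p) = tagged q}.

Definition elt_comp (A : Category) (X : SetFunctor A) (p q r : {a : A & X a})
  (g : elt_hom q r) (f : elt_hom p q) : elt_hom p r.
Proof.
exists (comp (sval g) (sval f)).
by rewrite smap_comp (svalP f) (svalP g).
Defined.

Lemma elt_hom_eq (A : Category) (X : SetFunctor A) (p q : {a : A & X a})
  (f g : elt_hom p q) : sval f = sval g -> f = g.
Proof.
case: f g => [f Hf] [g Hg] /= fg; case: _ / fg Hg => Hg.
by congr exist; apply: Prop_irrelevance.
Qed.

Definition Elements (A : Category) (X : SetFunctor A) : Category.
Proof.
refine (@MkCategory {a : A & X a} (@elt_hom A X)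
  (fun p => exist _ (idm (tag p)) (smap_id (tagged p)))
  (@elt_comp A X) _ _ _).
- by move=> p q f; apply: elt_hom_eq; apply: comp_idl.
- by move=> p q f; apply: elt_hom_eq; apply: comp_idr.
- by move=> p q r s h g f; apply: elt_hom_eq; apply: comp_assoc.
Defined.

Record Cone (D X : Category) (F : Functor D X) := MkCone {
  apex : X;
  leg : forall d, hom apex (F d);
  leg_natural : forall d d' (u : hom d d'), comp (fmap F u) (leg d) = leg d' }.

Definition factors_through (D X : Category) (F : Functor D X) (c c' : Cone F) :
  Prop :=
  exists u : hom (apex c) (apex c'), forall d, comp (leg c' d) u = leg c d.

Definition finite_category (D : Category) : Prop :=
  finite_set [set: ob D] /\ forall d d' : D, finite_set [set: hom d d'].

Definition cofiltering (X Y : Category) (F : Functor X Y) : Prop :=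
  forall (D : Category) (G : Functor D X), finite_category D ->
    inhabited (Cone (comp_functor F G)).

(* The empty diagram is included, so a cofiltered category has an object. *)
Definition cofiltered (X : Category) : Prop :=
  forall (D : Category) (G : Functor D X), finite_category D ->
    inhabited (Cone G).

Definition flat (A : Category) (X : SetFunctor A) : Prop :=
  cofiltered (Elements X).

Definition module_on (A : Category) := SetFunctor (prod_cat (op_cat A) A).

Section Modules.
Variables (A : Category) (M : module_on A).

(* m @ f *)
Definition actr (a a' b : A) (m : M (a, b)) (f : hom a' a) : M (a', b) :=
  @smap _ M (a, b) (a', b) (f, idm b) m.

(* g @ m *)
Definition actl (a b b' : A) (g : hom b b') (m : M (a, b)) : M (a, b') :=
  @smap _ M (a, b) (a, b') (idm a, g) m.

Lemma actr_id (a b : A) (m : M (a, b)) : actr m (idm a) = m.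
Proof. exact: (@smap_id _ M (a, b)). Qed.

Lemma actl_id (a b : A) (m : M (a, b)) : actl (idm b) m = m.
Proof. exact: (@smap_id _ M (a, b)). Qed.

Lemma actr_comp (a a' a'' b : A) (m : M (a, b)) (f : hom a' a) (f' : hom a'' a') :
  actr m (comp f f') = actr (actr m f) f'.
Proof.
rewrite /actr -(@smap_comp _ M (a, b) (a', b) (a'', b)) /=.
by rewrite comp_idl.
Qed.

Lemma actl_comp (a b b' b'' : A) (m : M (a, b)) (g : hom b b') (g' : hom b' b'') :
  actl (comp g' g) m = actl g' (actl g m).
Proof.
rewrite /actl -(@smap_comp _ M (a, b) (a, b') (a, b'')) /=.
by rewrite comp_idl.
Qed.

Lemma actlr (a a' b b' : A) (m : M (a, b)) (f : hom a' a) (g : hom b b') :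
  actr (actl g m) f = actl g (actr m f).
Proof.
rewrite /actl /actr -(@smap_comp _ M (a, b) (a, b') (a', b')) /=.
rewrite -(@smap_comp _ M (a, b) (a', b) (a', b')) /=.
by rewrite !comp_idl !comp_idr.
Qed.

Definition module_at (a : A) : SetFunctor A :=
  @MkSetFunctor A (fun b => M (a, b)) (fun b b' g m => actl g m)
    (fun b m => actl_id m) (fun b b' b'' g' g m => actl_comp m g g').

Definition flat_module : Prop := forall a : A, flat (module_at a).

Record complex := MkComplex {
  cob :> nat -> A;
  cel : forall n, M (cob n.+1, cob n) }.

Record complex_hom (x y : complex) := MkComplexHom {
  chom :> forall n, hom (x n) (y n);
  chomE : forall n, actr (cel y n) (chom n.+1) = actl (chom n) (cel x n) }.

Lemma complex_hom_eq x y (f g : complex_hom x y) :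
  (forall n, f n = g n) -> f = g.
Proof.
case: f g => [f Hf] [g Hg] /= fg.
have {}fg : f = g by apply: functional_extensionality_dep.
by case: _ / fg Hg => Hg; congr MkComplexHom; apply: Prop_irrelevance.
Qed.

Definition complex_id (x : complex) : complex_hom x x.
Proof.
by refine (@MkComplexHom x x (fun n => idm (x n)) _) => n; rewrite actr_id actl_id.
Defined.

Definition complex_comp (x y z : complex)
  (g : complex_hom y z) (f : complex_hom x y) : complex_hom x z.
Proof.
refine (@MkComplexHom x z (fun n => comp (g n) (f n)) _) => n.
by rewrite actr_comp chomE actlr chomE actl_comp.
Defined.

Definition Complex : Category.
Proof.
refine (@MkCategory complex complex_hom complex_id complex_comp _ _ _).
- by move=> x y f; apply: complex_hom_eq => n; apply: comp_idl.
- by move=> x y f; apply: complex_hom_eq => n; apply: comp_idr.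
- by move=> x y z t h g f; apply: complex_hom_eq => n; apply: comp_assoc.
Defined.

Section Truncated.
Variable n : nat.

(* For i : 'I_n, the indices i and i + 1 of 'I_n.+1. *)
Definition olow (i : 'I_n) : 'I_n.+1 := widen_ord (leqnSn n) i.
Definition ohigh (i : 'I_n) : 'I_n.+1 := lift ord0 i.

Record tcomplex := MkTComplex {
  tob :> 'I_n.+1 -> A;
  tel : forall i : 'I_n, M (tob (ohigh i), tob (olow i)) }.

Record tcomplex_hom (x y : tcomplex) := MkTComplexHom {
  thom :> forall i, hom (x i) (y i);
  thomE : forall i : 'I_n,
    actr (tel y i) (thom (ohigh i)) = actl (thom (olow i)) (tel x i) }.

Lemma tcomplex_hom_eq x y (f g : tcomplex_hom x y) :
  (forall i, f i = g i) -> f = g.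
Proof.
case: f g => [f Hf] [g Hg] /= fg.
have {}fg : f = g by apply: functional_extensionality_dep.
by case: _ / fg Hg => Hg; congr MkTComplexHom; apply: Prop_irrelevance.
Qed.

Definition tcomplex_id (x : tcomplex) : tcomplex_hom x x.
Proof.
by refine (@MkTComplexHom x x (fun i => idm (x i)) _) => i; rewrite actr_id actl_id.
Defined.

Definition tcomplex_comp (x y z : tcomplex)
  (g : tcomplex_hom y z) (f : tcomplex_hom x y) : tcomplex_hom x z.
Proof.
refine (@MkTComplexHom x z (fun i => comp (g i) (f i)) _) => i.
by rewrite actr_comp thomE actlr thomE actl_comp.
Defined.

Definition TComplex : Category.
Proof.
refine (@MkCategory tcomplex tcomplex_hom tcomplex_id tcomplex_comp _ _ _).
- by move=> x y f; apply: tcomplex_hom_eq => i; apply: comp_idl.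
- by move=> x y f; apply: tcomplex_hom_eq => i; apply: comp_idr.
- by move=> x y z t h g f; apply: tcomplex_hom_eq => i; apply: comp_assoc.
Defined.

Definition trunc (x : complex) : tcomplex :=
  @MkTComplex (fun i => x i) (fun i => cel x i).

Definition trunc_hom (x y : complex) (f : complex_hom x y) :
  tcomplex_hom (trunc x) (trunc y) :=
  @MkTComplexHom (trunc x) (trunc y) (fun i => f i) (fun i => chomE f i).

Definition pr : Functor Complex TComplex.
Proof.
refine (@MkFunctor Complex TComplex trunc trunc_hom _ _).
- by move=> x; apply: tcomplex_hom_eq.
- by move=> x y z g f; apply: tcomplex_hom_eq.
Defined.

End Truncated.

(* [TComplex 0] is isomorphic, not definitionally equal, to [A]; see
   [TComplex0_iso] below. *)
Definition ev0 : Functor (TComplex 0) A :=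
  @MkFunctor (TComplex 0) A (fun x : tcomplex 0 => x ord0)
    (fun (x y : tcomplex 0) (f : tcomplex_hom x y) => f ord0)
    (fun x => erefl) (fun x y z g f => erefl).

Definition weak_solvability : Prop := cofiltering (pr 0).

Definition strong_solvability : Prop := cofiltered Complex.

End Modules.

Lemma TComplex0_iso (A : Category) (M : module_on A) :
  bijective (ev0 M) /\
  forall x y : TComplex M 0,
    bijective (fun f : hom x y => fmap (ev0 M) f).
Proof.
split.
  have el0 (a : A) (i : 'I_0) : M (a, a) by case: i.
  exists (fun a => @MkTComplex A M 0 (fun=> a) (el0 a)) => // -[x m] /=.
  have E : (fun=> x ord0) = x.
    by apply: functional_extensionality_dep => i; rewrite (ord1 i).
  case: _ / E m => m; congr MkTComplex.
  by apply: functional_extensionality_dep => -[].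
move=> x y.
have ext (f : hom (x ord0) (y ord0)) (i : 'I_1) : hom (x i) (y i).
  by rewrite (ord1 i).
have injF : injective (fun f : hom x y => fmap (ev0 M) f).
  by move=> f g /= fg; apply: tcomplex_hom_eq => i; rewrite (ord1 i).
have surjF (f : hom (x ord0) (y ord0)) :
    {g : hom x y | fmap (ev0 M) g = f}.
  pose h (i : 'I_1) : hom (x i) (y i) :=
    let: erefl := esym (ord1 i) in f.
  have H (i : 'I_0) :
      actr (tel y i) (h (ohigh i)) = actl (h (olow i)) (tel x i) by case: i.
  exists (@MkTComplexHom A M 0 x y h H) => /=.
  by rewrite /h (Prop_irrelevance (ord1 ord0) erefl).
exists (fun f => sval (surjF f)) => [f|f]; last exact: (svalP (surjF f)).
by apply: injF; exact: (svalP (surjF _)).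
Qed.

Record Preorder := MkPreorder {
  point :> Type;
  ple : point -> point -> Prop;
  ple_refl : forall x, ple x x;
  ple_trans : forall x y z, ple x y -> ple y z -> ple x z }.
Arguments ple {p} _ _.

Definition final_subset (X : Preorder) (S : set X) : Prop :=
  forall x : X, exists2 s : X, S s & ple x s.

Definition cone_preorder (D X : Category) (F : Functor D X) : Preorder.
Proof.
refine (@MkPreorder (Cone F) (@factors_through D X F) _ _).
- by move=> c; exists (idm (apex c)) => d; rewrite comp_idr.
- move=> c c' c'' [u Hu] [v Hv]; exists (comp v u) => d.
  by rewrite comp_assoc Hv Hu.
Defined.

Definition PD (A : Category) (M : module_on A) (D : Category)
  (G : Functor D (Complex M)) (n : nat) : Preorder :=
  cone_preorder (comp_functor (pr M n) G).

Definition compact_module (A : Category) (M : module_on A) : Prop :=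
  forall (D : Category) (G : Functor D (Complex M)) (n : nat),
    finite_category D -> inhabited D ->
    exists S : set (PD G n),
      [/\ (S !=set0)%classic, finite_set S & final_subset S].

(* Main.v *)
(** By compactness each preorder [PD G n] has a nonempty finite final subset
    [S n], and truncating a cone in [S n.+1] gives a cone which factors through
    one in [S n].  König's lemma yields cones [c n] together with morphisms [u n]
    from the truncation of the apex of [c n.+1] to the apex of [c n].  These
    apexes are not strict truncations of one another, but their top objects
    [a n] form a complex: push the last element of the apex of [c n.+1] forward
    along the component at [n] of [u n] to get an element of [M (a n.+1, a n)].
    The top components of the legs then form a cone over [G]. *)
From mathcomp Require Import all_boot boolp classical_sets cardinality.
Require Import Defs.

Set Implicit Arguments.
Unset Strict Implicit.
Unset Printing Implicit Defensive.

(** Pigeonhole: if each of the finitely many [t] failed some [Q k t], all would fail at the largest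
    such [k], as [Q] is decreasing in [k]. *)
Lemma finite_set_uniform_witness (T : Type) (S : set T) (Q : nat -> T -> Prop) :
  finite_set S ->
  (forall k t, Q k.+1 t -> Q k t) ->
  (forall k, exists2 t, S t & Q k t) ->
  exists2 t, S t & forall k, Q k t.
Proof.
move=> /(@finite_seqP {classic T})[s ->] Qdec.
have Qle k l t : k <= l -> Q l t -> Q k t.
  by move=> /subnK <-; elim: (l - k) => // j IH /Qdec.
elim: s => [/(_ 0)[]//|x s IH Qs].
have [Qx|/existsNP[k0 nQx]] := pselect (forall k, Q k x).
  by exists x => //=; rewrite mem_head.
have [k|t ts Qt] := IH; last by exists t => //=; rewrite inE [t \in s]ts orbT.
(* A witness at [maxn k k0] cannot be [x], which fails at [k0], so it lies in the tail. *)
have [t /= ts Qt] := Qs (maxn k k0).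
exists t; last by apply: Qle Qt; rewrite leq_maxl.
move: ts; rewrite inE => /orP[/eqP tx|//].
by case: nQx; rewrite -tx; apply: Qle Qt; rewrite leq_maxr.
Qed.

Section Konig.
Variables (T : nat -> Type) (S : forall n, set (T n)).
Variable R : forall n, T n.+1 -> T n -> Prop.
Arguments R {n} _ _.

Fixpoint has_chain (k n : nat) (s : T n) : Prop :=
  if k is k'.+1 then exists2 t, S t & R t s /\ has_chain k' t else True.

Lemma has_chainS k n (s : T n) : has_chain k.+1 s -> has_chain k s.
Proof.
elim: k n s => // k IH n s [t St [Rts ch]].
by exists t => //; split=> //; apply: IH.
Qed.

Lemma konig :
  (forall n, (@S n !=set0)%classic) -> (forall n, finite_set (@S n)) ->
  (forall n (t : T n.+1), S t -> exists2 s, S s & R t s) ->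
  exists c : forall n, T n, forall n, R (c n.+1) (c n).
Proof.
move=> S0 Sfin SR.
(* Start at level [n + k] and descend along [SR]. *)
have ex_chain k n : exists2 s : T n, S s & has_chain k s.
  elim: k n => [|k IH] n; first by have [s Ss] := S0 n; exists s.
  have [t St ch] := IH n.+1; have [s Ss Rts] := SR _ _ St.
  by exists s => //; exists t.
(* The invariant is to have chains of every length: each chain of length [k.+1] at [s] has its first
   step in the finite [S n.+1], and a single first step serves all [k]. *)
have step n (s : {s : T n | forall k, has_chain k s}) :
    {t : {t : T n.+1 | forall k, has_chain k t} | R (sval t) (sval s)}.
  apply: cid; case: s => s ch /=.
  have [k t [/has_chainS ? ?]||t _ Rch] := @finite_set_uniform_witness _ _
    (fun k t => has_chain k t /\ R t s) (Sfin n.+1); first by split.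
    by move=> k; have [t St [Rts cht]] := ch k.+1; exists t.
  have cht k : has_chain k t by have [] := Rch k.
  by exists (exist _ t cht); have [] := Rch 0.
have [s0 _ ch0] := finite_set_uniform_witness (Sfin 0)
  (fun k t => @has_chainS k 0 t) (fun k => ex_chain k 0).
pose c := fix c n : {s : T n | forall k, has_chain k s} :=
  if n is n'.+1 then sval (step n' (c n')) else exist _ s0 ch0.
by exists (fun n => sval (c n)) => n; exact: (svalP (step n (c n))).
Qed.

End Konig.

Section Truncation.
Variables (A : Category) (M : module_on A).

(* [ohigh k] is only propositionally equal to the ordinals naming the same
   index below, hence the transport. *)
Definition tel_at n (x : tcomplex M n) (k : 'I_n) (j : 'I_n.+1)
  (e : ohigh k = j) : M (x j, x (olow k)) :=
  let: erefl := e in tel x k.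

Lemma thomE_at n (x y : tcomplex M n) (f : tcomplex_hom x y) (k : 'I_n)
  (j : 'I_n.+1) (e : ohigh k = j) :
  actr (tel_at y e) (f j) = actl (f (olow k)) (tel_at x e).
Proof. by case: _ / e; apply: thomE. Qed.

Lemma tel_at_trunc n (x : complex M) (k : 'I_n) (lt_k : k.+1 < n.+1)
  (e : ohigh k = Ordinal lt_k) :
  tel_at (trunc n x) e = cel x k.
Proof.
(* Once [lt_k] is the bound proof carried by [ohigh k], [e] is a loop and the transport along it is
   trivial. *)
move: e; rewrite (bool_irrelevance lt_k (@lift_subproof n.+1 0 k)) => e.
by rewrite (Prop_irrelevance e erefl).
Qed.

Lemma ohigh_olow n (i : 'I_n) : ohigh (olow i) = olow (ohigh i).
Proof. exact: val_inj. Qed.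

Lemma ohigh_max n : ohigh (@ord_max n) = ord_max.
Proof. exact: val_inj. Qed.

Definition ttrunc n (x : tcomplex M n.+1) : tcomplex M n :=
  @MkTComplex A M n (fun i => x (olow i)) (fun i => tel_at x (ohigh_olow i)).

Variables (D : Category) (G : Functor D (Complex M)).

Lemma trunc_legE n (c : PD G n.+1) d (i : 'I_n) :
  actr (tel (trunc n (G d)) i) (leg c d (olow (ohigh i))) =
  actl (leg c d (olow (olow i))) (tel (ttrunc (apex c)) i).
Proof.
rewrite -[RHS](thomE_at (leg c d)) /=.
by congr (actr _ _); rewrite [RHS]tel_at_trunc.
Qed.

Definition trunc_leg n (c : PD G n.+1) d :
  tcomplex_hom (ttrunc (apex c)) (trunc n (G d)) :=
  @MkTComplexHom A M n (ttrunc (apex c)) (trunc n (G d))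
    (fun i => leg c d (olow i)) (trunc_legE c d).

Lemma trunc_leg_natural n (c : PD G n.+1) d d' (u : hom d d') :
  comp (fmap (comp_functor (pr M n) G) u) (trunc_leg c d) = trunc_leg c d'.
Proof.
apply: tcomplex_hom_eq => i.
exact: (congr1 (fun f : tcomplex_hom _ _ => f (olow i)) (leg_natural c u)).
Qed.

Definition trunc_cone n (c : PD G n.+1) : PD G n :=
  @MkCone D (TComplex M n) (comp_functor (pr M n) G) (ttrunc (apex c))
    (trunc_leg c) (@trunc_leg_natural n c).

Lemma cone_of_chain (c : forall n, PD G n) :
  (forall n, ple (trunc_cone (c n.+1)) (c n)) -> inhabited (Cone G).
Proof.
move=> /(_ _)/cid c_desc.
pose u n : tcomplex_hom (ttrunc (apex (c n.+1))) (apex (c n)) :=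
  sval (c_desc n).
pose a n := (apex (c n) : tcomplex M n) ord_max.
pose m n : M (a n.+1, a n) :=
  actl (u n ord_max) (tel_at (apex (c n.+1)) (ohigh_max n)).
pose x := MkComplex m.
pose l d n : hom (x n) ((G d : complex M) n) := leg (c n) d ord_max.
have lE d n : actr (cel (G d) n) (l d n.+1) = actl (l d n) (cel x n).
  rewrite /= /m -actl_comp.
  (* The factorization through [c n], read at index [n], reduces the goal to the compatibility of a
     leg of [c n.+1] with the last elements. *)
  have -> : comp (l d n) (u n ord_max) = leg (c n.+1) d (olow ord_max).
    exact: (congr1 (fun f : tcomplex_hom _ _ => f ord_max)
              (svalP (c_desc n) d)).
  rewrite -[RHS](thomE_at (leg (c n.+1) d)).
  by congr (actr _ _); rewrite [RHS]tel_at_trunc.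
constructor; apply: (@MkCone D (Complex M) G x
  (fun d => MkComplexHom (lE d))) => d d' v.
apply: complex_hom_eq => n.
exact: (congr1 (fun f : tcomplex_hom _ _ => f ord_max)
          (leg_natural (c n) v)).
Qed.

End Truncation.

Theorem theorem5p14 (A : Category) (M : module_on A) :
  flat_module M ->
  inhabited (Complex M) ->
  compact_module M ->
  weak_solvability M ->
  strong_solvability M.
Proof.
move=> _ [x0] cpt _ D G Dfin.
have [D0|Dempty] := pselect (inhabited D); last first.
  have no_ob (d : D) : False by apply: Dempty.
  (* Compactness only concerns nonempty diagrams; over the empty one any complex is the apex of a
     cone. *)
  constructor; apply: (@MkCone D (Complex M) G x0
    (fun d => False_rect _ (no_ob d))).
  by move=> d; case: (no_ob d).
have /(_ _)/cid S n := cpt D G n Dfin D0.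
have [||n t _|c cP] := @konig (PD G) (fun n => sval (S n))
  (fun n t s => ple (trunc_cone t) s).
- by move=> n; have [] := svalP (S n).
- by move=> n; have [] := svalP (S n).
- by have [_ _ /(_ (trunc_cone t))] := svalP (S n).
- exact: cone_of_chain cP.
Qed.
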